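(* For all ordinary counting renewal processes $(A(s),s\in\mathbb R_+)$, all $m\in\mathbb N$ and all $t\in\mathbb R_+$, $$E\,A(t)^m\le2^{m-1}\Big((1+\lambda t)^m\big(1+m\,E(\lambda\xi)^2\big)^m+m^m\Big).$$ There exists $C'>1$ such that, for all inter-arrival times $\xi$, all $t\in\mathbb R_+$ and all $m\in\mathbb N$, $$E\,A'(t)^m\le C'^{\,m}\Big((1+\lambda t)^m\big(1+m\,E(\lambda\xi)^2\big)^m+m^m\Big).$$
   Context: $(A(t),t\in\mathbb R_+)$ is an ordinary counting renewal process of rate $\lambda\in(0,\infty)$: $A(t)=\max\{i\ge0:\xi_1+\dots+\xi_i\le t\}$ with i.i.d. positive inter-arrival times $\xi_1,\xi_2,\ldots$ distributed as $\xi$, $E\xi=1/\lambda$. $(A'(t),t\in\mathbb R_+)$ is the associated equilibrium counting renewal process: the delayed renewal counting process with the same inter-arrival distribution whose first renewal epoch has cdf $\lambda\int_0^xP(\xi>y)\,dy$. $E(\lambda\xi)^2$ means $E[(\lambda\xi)^2]$. The constant $C'$ is universal (it does not depend on the distribution of $\xi$, on $\lambda$, $t$ or $m$). *)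

(* Defs.v *)
From HB Require Import structures.
From mathcomp Require Import all_boot all_order all_algebra.
From mathcomp Require Import all_classical all_reals all_analysis.

Set Implicit Arguments.
Unset Strict Implicit.
Unset Printing Implicit Defensive.

Import Order.TTheory GRing.Theory Num.Theory.

Local Open Scope classical_set_scope.
Local Open Scope ring_scope.
Local Open Scope ereal_scope.

Definition mutually_independent (d : measure_display) (T : measurableType d)
    (R : realType) (P : probability T R) (X : nat -> {RV P >-> R}) : Prop :=
  forall (J : seq nat) (B : nat -> set R),
    uniq J -> (forall j, measurable (B j)) ->
    P (\bigcap_(j in [set` J]) (X j @^-1` B j)) =
    \prod_(j <- J) P (X j @^-1` B j).

(* [xi 0], [xi 1], ... are the inter-arrival times xi_1, xi_2, ...: sequences
   start at index 0, so [xi 0] also plays the role of the generic xi. *)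
Record renewal_sequence (d : measure_display) (T : measurableType d)
    (R : realType) (P : probability T R) (lambda : R)
    (xi : nat -> {RV P >-> R}) : Prop := RenewalSequence {
  renewal_indep : mutually_independent xi ;
  renewal_ident : forall (i : nat) (B : set R), measurable B ->
    distribution P (xi i) B = distribution P (xi 0%N) B ;
  renewal_pos : forall i : nat, {ae P, forall w, (0 < xi i w)%R} ;
  renewal_mean : 'E_P[xi 0%N] = (lambda^-1)%:E
}.

(* Prepends the delay [D] to the inter-arrival times [xi]. *)
Definition delayed (d : measure_display) (T : measurableType d)
    (R : realType) (P : probability T R) (D : {RV P >-> R})
    (xi : nat -> {RV P >-> R}) (i : nat) : {RV P >-> R} :=
  if i is j.+1 then xi j else D.

(* The cdf of [D] is prescribed on [0, +oo[ only; its value 0 at 0 forces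
   [D] to be almost surely positive. *)
Record equilibrium_renewal_sequence (d : measure_display)
    (T : measurableType d) (R : realType) (P : probability T R) (lambda : R)
    (D : {RV P >-> R}) (xi : nat -> {RV P >-> R}) : Prop :=
  EquilibriumRenewalSequence {
  equilibrium_renewal : renewal_sequence lambda xi ;
  equilibrium_indep : mutually_independent (delayed D xi) ;
  equilibrium_cdf : forall x : R, (0 <= x)%R ->
    cdf D x =
    lambda%:E * \int[lebesgue_measure]_(y in `[0%R, x]) ccdf (xi 0%N) y
}.

(* max {i >= 0 : X_1 + ... + X_i <= t}. The set contains 0 for t >= 0 and is
   almost surely bounded for the sequences above, so that the supremum is
   almost surely a maximum; it is +oo on the null set where the set is
   unbounded. *)
Definition renewal_count (d : measure_display) (T : measurableType d)
    (R : realType) (P : probability T R) (X : nat -> {RV P >-> R})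
    (t : R) (w : T) : \bar R :=
  ereal_sup [set (i%:R)%:E | i in [set i : nat |
    (\sum_(k < i) X k w <= t)%R]].

(* (1 + lambda t)^m (1 + m E[(lambda xi)^2])^m + m^m, with xi the generic
   inter-arrival time; it is +oo when m > 0 and xi has no second moment. *)
Definition moment_bound (d : measure_display) (T : measurableType d)
    (R : realType) (P : probability T R) (lambda : R) (xi : {RV P >-> R})
    (t : R) (m : nat) : \bar R :=
  ((1 + lambda * t) ^+ m)%:E *
    (1 + m%:R%:E * 'E_P[fun w => ((lambda * xi w) ^+ 2)%R]) ^+ m +
  (m%:R ^+ m)%:E.

(* Main.v *)
Require Import Defs.
From HB Require Import structures.
From mathcomp Require Import all_boot all_order all_algebra.
From mathcomp Require Import all_classical all_reals all_analysis.
From mathcomp Require Import measurable_realfun ring lra.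

(** Both processes are instances of one setting: independent times [X 0],
    [X 1], [X 2], ..., almost surely nonnegative, where [X 1], [X 2], ... have
    the law of the inter-arrival time xi and [X 0] is either xi itself or the
    delay.  Let S_n be the sum of the first n times, s = lambda t,
    b = E (lambda xi)^2 and p_n = P (S_n <= t).  The whole statement follows
    from the tail estimate

      p_j + p_(j+1) + p_(j+2) + ... <= U p_j   for j >= 1,  U = 2 s + b,

    which is Wald's identity for truncated times.  If S_j <= t, then the times
    min (X n) c summed over those n >= j for which S_n <= t add up to at most
    t + c: all but the last one fit in [0, t], and the last one is at most c
    ([wald_pointwise]).  Since X n is independent of the event S_n <= t
    ([early_indep]), taking expectations gives
    (p_j + p_(j+1) + ...) E (min xi c) <= (t + c) p_j ([early_tail]).  From
    x <= min x c + x^2 / (4 c) with c = b / (2 lambda) one gets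
    E (min xi c) >= 1 / (2 lambda) ([trunc_mean_ge]), hence the value of U.

    The moments then come from summation by parts.  A tail estimate with
    factor U turns the sum of n^m p_n into at most m U times the sum of
    n^(m-1) p_n, so the sum of n^m p_n over n >= 1 is at most m! U^(m+1)
    ([moment_sum_le]); as k^(m+1) is at most the sum of (m+1) n^m over
    1 <= n <= k, the count A satisfies E A^(m+1) <= (m+1)! U^(m+1).

    It remains to compare m! (2 s + b)^m with
    2^(m-1) ((1 + s) (1 + m b))^m ([moment_const_le]).  This uses b >= 1,
    which is E (lambda xi - 1)^2 >= 0, and 2 m! <= m^m for m >= 2. *)

Set Implicit Arguments.
Unset Strict Implicit.
Unset Printing Implicit Defensive.

Import Order.TTheory GRing.Theory Num.Theory.

Local Open Scope classical_set_scope.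
Local Open Scope ring_scope.
Local Open Scope ereal_scope.

(** * Sums of powers against a sequence with controlled tails *)

Section power_sums.
Local Open Scope ring_scope.

Lemma expr_succ_sub_le (R : realFieldType) (m n : nat) :
  n.+1%:R ^+ m.+1 - n%:R ^+ m.+1 <= m.+1%:R * n.+1%:R ^+ m :> R.
Proof.
rewrite subrXX -natrB// subSnn mul1r.
have -> : m.+1%:R * n.+1%:R ^+ m = \sum_(i < m.+1) n.+1%:R ^+ m :> R.
  by rewrite sumr_const card_ord mulr_natl.
apply: ler_sum => i _ /=.
rewrite -[X in _ <= _ ^+ X](subnK (ltnSE (ltn_ord i))) exprD ler_wpM2l ?exprn_ge0//.
by rewrite lerXn2r ?nnegrE// ler_nat.
Qed.

Lemma expr_le_sum_expr (R : realFieldType) (m n : nat) :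
  n%:R ^+ m.+1 <= \sum_(0 <= j < n) m.+1%:R * j.+1%:R ^+ m :> R.
Proof.
elim: n => [|n ih]; first by rewrite big_geq// expr0n.
rewrite big_nat_recr//=; have := expr_succ_sub_le R m n; lra.
Qed.

(** Summation by parts: a weight that is a prefix sum becomes a tail sum of
    the sequence [p]. *)
Lemma sum_prefix_mul (R : comPzRingType) (a p : nat -> R) (N : nat) :
  \sum_(0 <= n < N) (\sum_(0 <= j < n.+1) a j) * p n =
  \sum_(0 <= j < N) a j * \sum_(j <= n < N) p n.
Proof.
elim: N => [|N ih]; first by rewrite !big_geq.
rewrite big_nat_recr//= ih [RHS]big_nat_recr//= big_nat1 mulr_suml.
rewrite big_nat_recr//= addrA -big_split/=; congr (_ + _).
by apply: eq_big_nat => j /andP[_ jN]; rewrite big_nat_recr ?mulrDr// ltnW.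
Qed.

(** Each power of n costs one factor: n^(m+1) is dominated by the prefix sums
    of (m+1) j^m, and after summation by parts the hypothesis on tails replaces
    the tail sum starting at j by U p_j.  Here [p n] stands for the probability
    that n+1 arrivals occur in time, whence the weight n+1. *)
Lemma moment_sum_le (R : realFieldType) (p : nat -> R) (U : R) :
  (forall j, 0 <= p j) -> p 0 <= 1 -> 0 <= U ->
  (forall j N, \sum_(j <= n < N) p n <= U * p j) ->
  forall m N,
  \sum_(0 <= n < N) n.+1%:R ^+ m * p n <= m`!%:R * U ^+ m.+1.
Proof.
move=> p0 p01 U0 tail; elim=> [|m ih] N.
  rewrite fact0 mul1r expr1; under eq_bigr do rewrite expr0 mul1r.
  by rewrite (le_trans (tail _ _))// ler_piMr.
apply: (@le_trans _ _ (\sum_(0 <= n < N)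
    (\sum_(0 <= j < n.+1) m.+1%:R * j.+1%:R ^+ m) * p n)).
  by apply: ler_sum => n _; rewrite ler_wpM2r// expr_le_sum_expr.
rewrite sum_prefix_mul.
apply: (@le_trans _ _ (m.+1%:R * U * \sum_(0 <= n < N) n.+1%:R ^+ m * p n)).
  rewrite mulr_sumr; apply: ler_sum => j _.
  rewrite -!mulrA ler_wpM2l// mulrCA ler_wpM2l// exprn_ge0//.
rewrite (le_trans (ler_wpM2l _ (ih N))) ?mulr_ge0//.
by rewrite factS natrM (exprS U m.+1) mulrACA.
Qed.

Lemma double_fact_le (m : nat) : (1 < m)%N -> (2 * m`! <= m ^ m)%N.
Proof.
elim: m => // m ih; rewrite ltnS leq_eqVlt => /predU1P[<-//|m1].
rewrite factS mulnCA expnS leq_mul2l/= (leq_trans (ih m1))//.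
by rewrite leq_exp2r// ltnW.
Qed.

(** For exponents k >= 2 one has 2 s + b <= 2 b (1 + s), which produces a factor
    2^k, one factor 2 more than the right-hand side has; 2 k! <= k^k absorbs it.
    For k = 1 that is too wasteful, and 2 s + b <= (1 + s) (1 + b) is used. *)
Lemma moment_const_le (R : realFieldType) (m : nat) (s b : R) :
  0 <= s -> 1 <= b ->
  m.+1`!%:R * (2 * s + b) ^+ m.+1 <=
  2 ^+ m * ((1 + s) * (1 + m.+1%:R * b)) ^+ m.+1.
Proof.
move=> s0 b1; case: m => [|m].
  by rewrite factS fact0 !expr0 !expr1 !mul1r; nra.
have q0 : 0 <= m.+2%:R :> R by [].
have le2 : 2 * s + b <= 2 * (b * (1 + s)) by nra.
apply: (@le_trans _ _ (m.+2`!%:R * (2 * (b * (1 + s))) ^+ m.+2)).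
  by rewrite ler_wpM2l// lerXn2r ?nnegrE//; nra.
have -> : m.+2`!%:R * (2 * (b * (1 + s))) ^+ m.+2 =
    2 ^+ m.+1 * (2 * m.+2`!%:R * (b * (1 + s)) ^+ m.+2).
  by rewrite exprMn (exprS 2 m.+1); ring.
rewrite ler_wpM2l ?exprn_ge0//.
apply: (@le_trans _ _ (m.+2%:R ^+ m.+2 * (b * (1 + s)) ^+ m.+2)).
  rewrite ler_wpM2r ?exprn_ge0//; first nra.
  by rewrite -natrX -natrM ler_nat double_fact_le.
rewrite -exprMn lerXn2r ?nnegrE//.
- by apply: mulr_ge0 => //; nra.
- by apply: mulr_ge0; [nra|rewrite addr_ge0// mulr_ge0//; nra].
- have : 0 <= m.+2%:R * b by rewrite mulr_ge0//; nra.
  by rewrite mulrA; nra.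
Qed.

End power_sums.

(** * Truncated times and Wald's inequality along a path *)

Section truncation.
Context {R : realType}.
Implicit Types (c t : R) (x : nat -> R).
Local Open Scope ring_scope.

(** The cut at 0 makes the function nonnegative on the whole line, so that its
    integrals are monotone without integrability conditions. *)
Definition trunc c (y : R) : R := Num.min (Num.max y 0) c.

Lemma trunc_ge0 c y : 0 <= c -> 0 <= trunc c y.
Proof. by move=> c0; rewrite /trunc le_min c0 le_max lexx orbT. Qed.

Lemma trunc_le_cap c y : trunc c y <= c.
Proof. by rewrite /trunc ge_min lexx orbT. Qed.

Lemma trunc_le_self c y : 0 <= y -> trunc c y <= y.
Proof. by move=> y0; rewrite /trunc max_l// ge_min lexx. Qed.

Lemma measurable_trunc c : measurable_fun [set: R] (trunc c).
Proof. by apply: measurable_minr => //; exact: measurable_maxr. Qed.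

(** Above the cap this is (y - 2 c)^2 >= 0, that is y - c <= y^2 / (4 c). *)
Lemma max0_le_trunc c y : 0 < c -> Num.max y 0 <= trunc c y + y ^+ 2 / (4 * c).
Proof.
move=> c0; have q0 : 0 <= y ^+ 2 / (4 * c).
  by rewrite divr_ge0 ?sqr_ge0// mulr_ge0// ltW.
rewrite /trunc; case: (leP (Num.max y 0) c) => yc; first by rewrite lerDl.
have y0 : 0 < y by move: (lt_trans c0 yc); rewrite lt_max ltxx orbF.
rewrite max_l ?(ltW y0)// -lerBlDl ler_pdivlMr; last by rewrite mulr_gt0.
by have := sqr_ge0 (y - 2 * c); rewrite !expr2; nra.
Qed.

(** The bound is proved for the sums starting at 0, by induction: as long as
    the partial sum of the times is at most t, the truncated times add up to at
    most that partial sum; the first time that crosses t contributes at most c,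
    and nothing is added afterwards.  Starting the sum at j only removes
    nonnegative terms, and if S_j > t no term is left. *)
Lemma wald_pointwise c t x : 0 <= c -> 0 <= t -> (forall k, 0 <= x k) ->
  forall j N : nat,
  \sum_(j <= n < N) trunc c (x n) *+ (\sum_(k < n) x k <= t)%R <=
  (t + c) *+ (\sum_(k < j) x k <= t)%R.
Proof.
move=> c0 t0 x0 j N; set S := fun n : nat => \sum_(k < n) x k.
have SS n : S n.+1 = S n + x n by rewrite /S big_ord_recr.
have S0 : S 0%N = 0 by rewrite /S big_ord0.
have Snd m n : (m <= n)%N -> S m <= S n.
  move=> /subnKC <-; elim: (n - m)%N => [|k ih]; first by rewrite addn0.
  by rewrite addnS SS (le_trans ih)// lerDl.
have tr0 n := trunc_ge0 (x n) c0.
have [Sj|Sj] := leP (S j) t; last first.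
  rewrite big_nat big1// => n /andP[jn _].
  by rewrite -/(S n) leNgt (lt_le_trans Sj)// Snd.
have bound M : \sum_(0 <= n < M) trunc c (x n) *+ (S n <= t)%R <=
    Num.min (S M) (t + c).
  elim: M => [|M ih]; first by rewrite big_geq// S0 le_min lexx addr_ge0.
  rewrite big_nat_recr//= SS.
  move: ih; rewrite !le_min => /andP[ih1 ih2].
  have := x0 M; have := trunc_le_self c (x0 M); have := trunc_le_cap c (x M).
  by case: (leP (S M) t) => SM h1 h2 h3; rewrite ?mulr1n ?mulr0n ?addr0;
     apply/andP; split; lra.
have [jN|Nj] := leqP j N; last by rewrite big_geq ?(ltnW Nj)// addr_ge0.
apply: (@le_trans _ _ (\sum_(0 <= n < N) trunc c (x n) *+ (S n <= t)%R)).
  rewrite [leRHS](big_cat_nat (leq0n j) jN)/= lerDr sumr_ge0// => n _.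
  by rewrite mulrn_wge0.
by rewrite (le_trans (bound N))// ge_min lexx orbT.
Qed.

End truncation.

(** * Independence of a time from the sum of the previous ones *)

Section independence.
Context d (T : measurableType d) (R : realType) (P : probability T R).
Variable X : nat -> {RV P >-> R}.
Hypothesis indX : mutually_independent X.

(** At least [n] arrivals have occurred by time [t]. *)
Definition early (t : R) (n : nat) : set T := [set w | (\sum_(k < n) X k w <= t)%R].

Definition past_cylinder (n : nat) : set (set T) :=
  [set A | exists B : nat -> set R, (forall j, measurable (B j)) /\
    A = \bigcap_(j in [set` iota 0 n]) (X j @^-1` B j)].

Lemma measurable_past_cylinder n : past_cylinder n `<=` measurable.
Proof.
move=> _ [B [mB ->]]; apply: bigcap_measurableType => j _.
by rewrite -[X in measurable X]setTI; exact: measurable_funP.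
Qed.

Lemma setI_closed_past_cylinder n : setI_closed (past_cylinder n).
Proof.
move=> _ _ [B [mB ->]] [C [mC ->]]; exists (fun j => B j `&` C j); split.
  by move=> j; exact: measurableI.
by rewrite -bigcapI.
Qed.

Lemma early_past n t : <<s past_cylinder n >> (early t n).
Proof.
pose GT := g_sigma_algebraType (past_cylinder n).
have mX (k : 'I_n) : measurable_fun [set: GT] (X k : GT -> R).
  move=> _ B mB; rewrite setTI; apply: sub_sigma_algebra.
  exists (fun j => if j == k :> nat then B else setT); split.
    by move=> j; case: ifP.
  apply/seteqP; split=> w /=; last by move/(_ k); rewrite /= eqxx; apply;
    rewrite mem_iota ltn_ord.
  by move=> XB j _ /=; case: eqP => [->|].
have mS : measurable_fun [set: GT] (fun w => \sum_(k < n) X k w)%R.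
  exact: measurable_sum.
have := mS measurableT `]-oo, t]%classic (measurable_itv _).
by rewrite setTI /early set_itvNyc.
Qed.

Lemma measurable_early n t : measurable (early t n).
Proof.
apply: (smallest_sub (@sigma_algebra_measurable _ T)) (@early_past n t).
exact: measurable_past_cylinder.
Qed.

(** Dynkin's uniqueness argument: restricting P to the event X n \in B and
    scaling P by the probability of that event give two measures that agree on
    the cylinders over the first n times, a family closed under intersection,
    hence on every event determined by these times. *)
Lemma early_indep n t (B : set R) : measurable B ->
  P (early t n `&` X n @^-1` B) = P (early t n) * P (X n @^-1` B).
Proof.
move=> mB; have mXB : measurable (X n @^-1` B).
  by rewrite -[X in measurable X]setTI; exact: measurable_funP.
have PXB : (0 <= fine (P (X n @^-1` B)))%R by rewrite fine_ge0.
pose m1 := mrestr P mXB; pose m2 := mscale (NngNum PXB) P.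
have m2E A : m2 A = P A * P (X n @^-1` B).
  by rewrite /m2 /mscale/= fineK 1?muleC// fin_num_measure.
have m12 A : past_cylinder n A -> m1 A = m2 A.
  case=> C [mC ->]; rewrite m2E /m1 /mrestr.
  have := @indX (n :: iota 0 n) (fun j => if j == n then B else C j).
  rewrite /= iota_uniq mem_iota add0n ltnn.
  move=> /(_ erefl) /(_ _)/wrap[].
    by move=> j; case: ifP.
  have -> : [set` n :: iota 0 n] = n |` [set` iota 0 n].
    by apply/seteqP; split=> j /=; rewrite in_cons => /predU1P.
  rewrite bigcap_setU1 eqxx big_cons eqxx setIC.
  rewrite (@eq_bigcapr _ _ _ _ (fun j => X j @^-1` C j)); last first.
    by move=> j /=; rewrite mem_iota => /andP[_ jn]; rewrite (ltn_eqF jn).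
  move=> ->; rewrite indX ?iota_uniq// muleC; congr (_ * _).
  apply: eq_big_seq => j; rewrite mem_iota => /andP[_ jn].
  by rewrite (ltn_eqF jn).
rewrite [LHS](_ : _ = m1 (early t n))// -m2E.
apply: (g_sigma_algebra_measure_unique (past_cylinder n)
  (@measurable_past_cylinder n) (fun=> setT) _ _ m1 m2).
- move=> _; exists (fun=> setT); split=> //.
  by apply/seteqP; split.
- by rewrite bigcup_const.
- exact: setI_closed_past_cylinder.
- exact: m12.
- move=> _; apply: (@le_lt_trans _ _ 1); last exact: ltry.
  by apply: probability_le1; exact: measurableI.
- exact: early_past.
Qed.

End independence.

Section integral_on_independent_event.
Context d (T : measurableType d) (R : realType) (P : probability T R).

(** The law of Y under P restricted to E is P E times its law under P, and
    both sides are the integral of f against that measure. *)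
Lemma integral_indep (E : set T) (Y : {RV P >-> R}) (f : R -> \bar R) :
  measurable E -> measurable_fun setT f -> (forall y, 0 <= f y) ->
  (forall B, measurable B -> P (E `&` Y @^-1` B) = P E * P (Y @^-1` B)) ->
  \int[P]_(w in E) f (Y w) = P E * \int[P]_w f (Y w).
Proof.
move=> mE mf f0 indep.
have mfY : measurable_fun setT (f \o Y) by exact: measurableT_comp.
have PE : (0 <= fine (P E))%R by rewrite fine_ge0.
pose PE' := mrestr P mE.
transitivity (\int[PE']_w f (Y w)).
  rewrite -[in RHS](setUv E) ge0_integral_setU//=.
  - rewrite [X in _ = _ + X]null_set_integral ?adde0//.
    + by apply: eq_measure_integral => A mA AE; rewrite /PE' /= /mrestr setIidl.
    + exact: measurableC.
    + exact: measurable_funTS.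
    + by rewrite /PE' /= /mrestr setICl measure0.
  - exact: measurableC.
  - by rewrite setUv.
  - by rewrite disj_set2E setICr.
rewrite -(ge0_integral_pushforward (measurable_funPT Y) PE' measurableT mf)//.
transitivity (\int[mscale (NngNum PE) (distribution P Y)]_y f y).
  apply: eq_measure_integral => B mB _ /=.
  rewrite /pushforward /mscale/= /mrestr setIC indep// fineK//.
  by rewrite fin_num_measure.
rewrite ge0_integral_mscale//= fineK ?fin_num_measure//.
by rewrite ge0_integral_distribution.
Qed.

End integral_on_independent_event.

(** * Consequences of the first two moments *)

Section first_two_moments.
Context d (T : measurableType d) (R : realType) (P : probability T R).

Lemma mean_le_max0 (Y : {RV P >-> R}) :
  'E_P[Y] <= \int[P]_w (Num.max (Y w) 0)%:E.
Proof.
rewrite expectation_def integralE.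
rewrite (eq_integral (fun w => (Num.max (Y w) 0)%:E)); last first.
  by move=> w _; rewrite funeposE EFin_max.
by rewrite -[leRHS]sube0 leeB// integral_ge0.
Qed.

Lemma measurable_max0 (Y : {RV P >-> R}) :
  measurable_fun [set: T] (fun w => (Num.max (Y w) 0)%:E).
Proof. by apply/measurable_EFinP; exact: measurable_maxr. Qed.

Lemma measurable_sqrM (Y : {RV P >-> R}) (a : R) :
  measurable_fun [set: T] (fun w => ((a * Y w) ^+ 2)%:E).
Proof.
by apply/measurable_EFinP; apply: measurable_funX; exact: measurable_funM.
Qed.

(** With the cap c = b / (2 lambda), the loss E Y^2 / (4 c) is half of the mean
    1 / lambda. *)
Lemma trunc_mean_ge (Y : {RV P >-> R}) (lambda b : R) :
  (0 < lambda)%R -> (0 < b)%R -> 'E_P[Y] = (lambda^-1)%:E ->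
  'E_P[fun w => ((lambda * Y w) ^+ 2)%R] = b%:E ->
  ((2 * lambda)^-1)%:E <= \int[P]_w (trunc (b / (2 * lambda)) (Y w))%:E.
Proof.
move=> l0 b0 EY; rewrite unlock => EY2.
set c : R := (b / (2 * lambda))%R.
have c0 : (0 < c)%R by rewrite divr_gt0// mulr_gt0.
have mtr : measurable_fun [set: T] (fun w => (trunc c (Y w))%:E).
  by apply/measurable_EFinP; apply: measurableT_comp => //; exact: measurable_trunc.
have mq := measurable_sqrM Y lambda.
have a0 : (0 <= (2 * lambda * b)^-1)%R by rewrite invr_ge0 !mulr_ge0// ltW.
have : (lambda^-1)%:E <= \int[P]_w (trunc c (Y w))%:E + ((2 * lambda)^-1)%:E.
  rewrite -EY (le_trans (mean_le_max0 Y))//.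
  apply: (@le_trans _ _ (\int[P]_w ((trunc c (Y w))%:E +
      ((2 * lambda * b)^-1)%:E * ((lambda * Y w) ^+ 2)%:E))).
    apply: ge0_le_integral => //.
    - by move=> w _; rewrite lee_fin le_max lexx orbT.
    - exact: measurable_max0.
    - by apply: emeasurable_funD => //; exact: measurable_funeM.
    - move=> w _; rewrite -EFinM -EFinD lee_fin.
      have := max0_le_trunc (Y w) c0; congr (_ <= _ + _)%R; rewrite /c.
      by field; rewrite !gt_eqF.
  rewrite ge0_integralD//; last 3 first.
  - by move=> w _; rewrite lee_fin trunc_ge0// ltW.
  - by move=> w _; rewrite mule_ge0// lee_fin ?sqr_ge0.
  - exact: measurable_funeM.
  rewrite ge0_integralZl_EFin//; last by move=> w _; rewrite lee_fin sqr_ge0.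
  rewrite EY2 leeD2l// -EFinM lee_fin invfM -mulrA mulVf ?mulr1//.
  by rewrite gt_eqF.
rewrite -leeBlDr// -EFinB; congr (_%:E <= _).
by field; rewrite gt_eqF.
Qed.

(** Integrating 2 z <= 1 + z^2 with z = lambda Y gives 2 <= 1 + E z^2; the
    positive part of Y is used so that both sides are nonnegative. *)
Lemma second_moment_ge1 (Y : {RV P >-> R}) (lambda : R) :
  (0 < lambda)%R -> 'E_P[Y] = (lambda^-1)%:E ->
  1 <= 'E_P[fun w => ((lambda * Y w) ^+ 2)%R].
Proof.
move=> l0 EY; rewrite unlock.
have mq := measurable_sqrM Y lambda.
have mx := measurable_max0 Y.
have l20 : (0 <= 2 * lambda)%R by rewrite mulr_ge0// ltW.
have : (2 * lambda)%:E * \int[P]_w (Num.max (Y w) 0)%:E <=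
    1 + \int[P]_w ((lambda * Y w) ^+ 2)%:E.
  rewrite -ge0_integralZl_EFin//; last first.
    by move=> w _; rewrite lee_fin le_max lexx orbT.
  have -> : 1 + \int[P]_w ((lambda * Y w) ^+ 2)%:E =
      \int[P]_w (1 + ((lambda * Y w) ^+ 2)%:E).
    rewrite ge0_integralD//; last by move=> w _; rewrite lee_fin sqr_ge0.
    by rewrite integral_cst// [X in 1 * X + _](@probability_setT _ _ _ P) mule1.
  apply: ge0_le_integral => //.
  - by move=> w _; rewrite mule_ge0// lee_fin// le_max lexx orbT.
  - exact: measurable_funeM.
  - exact: emeasurable_funD.
  - move=> w _; rewrite -EFinM -EFinD lee_fin expr2.
    have [Y0|Y0] := leP (Y w) 0%R.
      by rewrite mulr0 addr_ge0// -expr2 sqr_ge0.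
    have := sqr_ge0 (lambda * Y w - 1)%R; rewrite !expr2; lra.
apply: contraTT; rewrite -!ltNge => E1.
have : 2%:E <= (2 * lambda)%:E * \int[P]_w (Num.max (Y w) 0)%:E.
  apply: (@le_trans _ _ ((2 * lambda)%:E * 'E_P[Y])).
    by rewrite EY -EFinM lee_fin -mulrA mulfV ?gt_eqF// mulr1.
  by rewrite lee_wpmul2l// mean_le_max0.
apply: lt_le_trans.
by rewrite (_ : 2 = 1 + 1)%R// EFinD lteD2lE.
Qed.

End first_two_moments.

(** * Wald's inequality in mean and the moments of the count *)

Section counting.
Context d (T : measurableType d) (R : realType) (P : probability T R).
Variable X : nat -> {RV P >-> R}.
Hypothesis indX : mutually_independent X.
Hypothesis X0 : {ae P, forall w, forall k, (0 <= X k w)%R}.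

Let S n w := (\sum_(k < n) X k w)%R.

Lemma mul_early_patch t n (f : T -> R) :
  (fun w => (f w *+ (S n w <= t)%R)%:E) = (EFin \o f) \_ (early X t n).
Proof.
apply/funext => w; rewrite patchE; case: ifPn.
  by rewrite inE /early/= => ->.
by rewrite notin_setE /early/= => /negP/negbTE ->.
Qed.

Lemma measurable_mul_early t n (f : T -> R) : measurable_fun setT f ->
  measurable_fun setT (fun w => (f w *+ (S n w <= t)%R)%:E).
Proof.
move=> mf; rewrite mul_early_patch.
apply/(measurable_restrictT _ (measurable_early X n t)).1.
by apply: measurable_funTS; exact/measurable_EFinP.
Qed.

Lemma integral_mul_early t n (f : T -> R) :
  \int[P]_w (f w *+ (S n w <= t)%R)%:E = \int[P]_(w in early X t n) (f w)%:E.
Proof. by rewrite mul_early_patch -integral_mkcond. Qed.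

(** Wald's inequality in mean.  The indices start at 1 because only the times
    after the possible delay [X 0] have a common truncated mean. *)
Lemma early_tail (c t : R) (mu : \bar R) : (0 <= c)%R -> (0 <= t)%R ->
  (forall k, \int[P]_w (trunc c (X k.+1 w))%:E = mu) ->
  forall j N, (\sum_(j.+1 <= n < N) P (early X t n)) * mu <=
    (t + c)%:E * P (early X t j.+1).
Proof.
move=> c0 t0 Emu j N; rewrite ge0_sume_distrl//.
have mtr n : measurable_fun [set: T] (fun w => trunc c (X n w)).
  by apply: measurableT_comp => //; exact: measurable_trunc.
rewrite (@eq_big_nat _ _ _ _ _ _ (fun n =>
  \int[P]_w (trunc c (X n w) *+ (S n w <= t)%R)%:E)); last first.
  move=> [//|n] _; rewrite -(Emu n) integral_mul_early.
  rewrite (integral_indep (E := early X t n.+1) (Y := X n.+1)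
    (f := fun y => (trunc c y)%:E))//.
  - exact: measurable_early.
  - by apply/measurable_EFinP; exact: measurable_trunc.
  - by move=> y; rewrite lee_fin trunc_ge0.
  - by move=> B mB; exact: early_indep.
rewrite -ge0_integral_sum//; last 2 first.
- by move=> n; exact: measurable_mul_early.
- by move=> n w _; rewrite lee_fin mulrn_wge0// trunc_ge0.
have -> : (t + c)%:E * P (early X t j.+1) =
    \int[P]_w ((t + c) *+ (S j.+1 w <= t)%R)%:E.
  rewrite (integral_mul_early t j.+1 (fun=> (t + c)%R)) integral_cst//.
  exact: measurable_early.
apply: ae_ge0_le_integral => //.
- by move=> w _; apply: sume_ge0 => n _; rewrite lee_fin mulrn_wge0// trunc_ge0.
- by apply: emeasurable_sum => n; exact: measurable_mul_early.
- by move=> w _; rewrite lee_fin mulrn_wge0// addr_ge0.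
- exact: (@measurable_mul_early t j.+1 (fun=> (t + c)%R)).
- apply: filterS X0 => w Xw _; rewrite sumEFin lee_fin.
  exact: wald_pointwise.
Qed.

(** The count as the supremum of a sequence of measurable functions: the
    indices outside of the original set contribute 0, which belongs to it. *)
Lemma renewal_countE (t : R) w : (0 <= t)%R ->
  renewal_count X t w = ereal_sup (range (fun i => (i%:R *+ (S i w <= t)%R)%:E)).
Proof.
move=> t0; apply/eqP; rewrite eq_le; apply/andP; split; apply: ge_ereal_sup.
  move=> _ [i Si <-]; apply: ereal_sup_ubound; exists i => //.
  by rewrite /= in Si; rewrite /S Si.
move=> _ [i _ <-]; case: (boolP (S i w <= t)%R) => Si.
  by apply: ereal_sup_ubound; exists i.
by apply: ereal_sup_ubound; exists 0%N => //=; rewrite big_ord0.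
Qed.

Lemma renewal_count_ge0 (t : R) w : (0 <= t)%R -> 0 <= renewal_count X t w.
Proof.
by move=> t0; apply: ereal_sup_ubound; exists 0%N => //=; rewrite big_ord0.
Qed.

Lemma measurable_renewal_countX (t : R) m : (0 <= t)%R ->
  measurable_fun [set: T] (fun w => renewal_count X t w ^+ m).
Proof.
move=> t0; have mc : measurable_fun [set: T] (renewal_count X t).
  rewrite (_ : renewal_count X t = fun w =>
    esups (fun i => (i%:R *+ (S i w <= t)%R)%:E) 0%N).
    apply: measurable_fun_esups => n.
    exact: (@measurable_mul_early t n (fun=> n%:R)).
  apply/funext => w; rewrite renewal_countE//.
  by congr ereal_sup; apply/seteqP; split=> _ [i _ <-]; exists i.
elim: m => [|m ih].
  by under eq_fun do rewrite expe0; exact: measurable_cst.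
by under eq_fun do rewrite expeS; exact: emeasurable_funM.
Qed.

(** For nonnegative times the indices n with S_n <= t form an initial segment,
    so the series dominates i^(m+1) for every i in it. *)
Lemma renewal_countX_le_series (t : R) m w : (0 <= t)%R ->
  (forall k, (0 <= X k w)%R) ->
  renewal_count X t w ^+ m.+1 <=
  \sum_(0 <= n <oo) ((m.+1%:R * n.+1%:R ^+ m) *+ (S n.+1 w <= t)%R)%:E.
Proof.
move=> t0 Xw; set y := limn _.
have term0 n : 0 <= ((m.+1%:R * n.+1%:R ^+ m) *+ (S n.+1 w <= t)%R)%:E :> \bar R.
  by rewrite lee_fin mulrn_wge0// mulr_ge0// exprn_ge0.
have Snd i n : (i <= n)%N -> (S i w <= S n w)%R.
  move=> /subnKC <-; elim: (n - i)%N => [|k ih]; first by rewrite addn0.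
  by rewrite addnS {2}/S big_ord_recr/= (le_trans ih)// lerDl.
have le_y i : (S i w <= t)%R -> (i%:R ^+ m.+1)%:E <= y.
  move=> Si; apply: le_trans (nneseries_lim_ge i _); last by move=> *.
  rewrite sumEFin lee_fin (le_trans (expr_le_sum_expr _ _ _))//.
  rewrite le_eqVlt; apply/orP; left; apply/eqP; apply: eq_big_nat => n /andP[_ ni].
  by rewrite (le_trans (Snd _ _ ni) Si).
have y0 : 0 <= y.
  by have := le_y 0%N; rewrite expr0n/=; apply; rewrite /S big_ord0.
move: y y0 le_y => [r| |]// r0 le_y; last exact: leey.
rewrite lee_fin in r0.
(* To pass from the members i of the set to their supremum, compare with the
   (m+1)-th root of the value of the series. *)
pose s : R := (r `^ m.+1%:R^-1)%R.
have s0 : (0 <= s)%R by exact: powR_ge0.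
have sm : (s ^+ m.+1 = r)%R.
  by rewrite -powR_mulrn// -powRrM mulVf// powRr1.
have le_s : renewal_count X t w <= s%:E.
  apply: ge_ereal_sup => _ [i Si <-]; rewrite lee_fin.
  by rewrite -(@ler_pXn2r _ m.+1)// ?nnegrE// sm -lee_fin le_y.
have ge0 := renewal_count_ge0 w t0.
have fin : renewal_count X t w \is a fin_num.
  by rewrite ge0_fin_numE// (le_lt_trans le_s)// ltry.
rewrite -(fineK fin) -EFin_expe lee_fin -sm lerXn2r// ?nnegrE ?fine_ge0//.
by rewrite -lee_fin fineK.
Qed.

Lemma renewal_count_le (t : R) m : (0 <= t)%R ->
  \int[P]_w (renewal_count X t w) ^+ m.+1 <=
  \sum_(0 <= n <oo) (m.+1%:R * n.+1%:R ^+ m)%:E * P (early X t n.+1).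
Proof.
move=> t0.
pose f n w := ((m.+1%:R * n.+1%:R ^+ m) *+ (S n.+1 w <= t)%R)%:E : \bar R.
have mf n : measurable_fun setT (f n).
  exact: (@measurable_mul_early t n.+1 (fun=> m.+1%:R * n.+1%:R ^+ m)%R).
have f0 n w : setT w -> 0 <= f n w.
  by move=> _; rewrite lee_fin mulrn_wge0// mulr_ge0// exprn_ge0.
rewrite [leRHS](_ : _ = \int[P]_w \sum_(0 <= n <oo) f n w); last first.
  rewrite integral_nneseries//; congr (limn _); apply/funext => N.
  apply: eq_bigr => n _.
  rewrite (integral_mul_early t n.+1 (fun=> m.+1%:R * n.+1%:R ^+ m)%R).
  by rewrite integral_cst//; exact: measurable_early.
apply: ae_ge0_le_integral => //.
- by move=> w _; rewrite expe_ge0// renewal_count_ge0.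
- exact: measurable_renewal_countX.
- by move=> w _; apply: nneseries_ge0 => n _ _; exact: f0.
- by apply: ge0_emeasurable_sum => // n w _ _; exact: f0.
- by apply: filterS X0 => w Xw _; exact: renewal_countX_le_series.
Qed.

End counting.

(** * The moment bound for a possibly delayed sequence *)

Section delayed_moment_bound.
Context d (T : measurableType d) (R : realType) (P : probability T R).
Variables (X : nat -> {RV P >-> R}) (Y : {RV P >-> R}) (lambda : R).
Hypothesis indX : mutually_independent X.
Hypothesis X0 : {ae P, forall w, forall k, (0 <= X k w)%R}.
Hypothesis XY : forall k B, measurable B ->
  distribution P (X k.+1) B = distribution P Y B.
Hypothesis l0 : (0 < lambda)%R.
Hypothesis EY : 'E_P[Y] = (lambda^-1)%:E.

Lemma early_prob_tail (b t : R) : (0 <= t)%R -> (0 < b)%R ->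
  'E_P[fun w => ((lambda * Y w) ^+ 2)%R] = b%:E ->
  forall j N : nat,
  (\sum_(j <= n < N) fine (P (early X t n.+1)) <=
     (2 * (lambda * t) + b) * fine (P (early X t j.+1)))%R.
Proof.
move=> t0 b0 EY2 j N.
have l20 : (0 < 2 * lambda)%R by rewrite mulr_gt0.
have c0 : (0 <= b / (2 * lambda))%R by rewrite divr_ge0 ?ltW.
have Pfin n : P (early X t n) \is a fin_num.
  by rewrite fin_num_measure//; exact: measurable_early.
have same_trunc k : \int[P]_w (trunc (b / (2 * lambda)) (X k.+1 w))%:E =
    \int[P]_w (trunc (b / (2 * lambda)) (Y w))%:E.
  have mtr : measurable_fun [set: R] (fun y => (trunc (b / (2 * lambda)) y)%:E).
    by apply/measurable_EFinP; exact: measurable_trunc.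
  have tr0 y : 0 <= (trunc (b / (2 * lambda)) y)%:E by rewrite lee_fin trunc_ge0.
  rewrite -(ge0_integral_distribution (X k.+1) mtr)//.
  rewrite -(ge0_integral_distribution Y mtr)//.
  by apply: eq_measure_integral => B mB _; exact: XY.
have := early_tail indX X0 c0 t0 same_trunc j N.+1.
rewrite big_add1/=; under eq_bigr do rewrite -(fineK (Pfin _)).
rewrite sumEFin -(fineK (Pfin j.+1)) -EFinM => tail.
set s := (\sum_(j <= n < N) _)%R in tail *.
have s0 : (0 <= s)%R by apply: sumr_ge0 => n _; rewrite fine_ge0.
have : s%:E * ((2 * lambda)^-1)%:E <=
    ((t + b / (2 * lambda)) * fine (P (early X t j.+1)))%:E.
  by rewrite (le_trans _ tail)// lee_wpmul2l ?lee_fin// trunc_mean_ge.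
rewrite -EFinM lee_fin ler_pdivrMr//; congr (_ <= _)%R.
by field; rewrite gt_eqF.
Qed.

(** For m = 0 both sides are equal to 1, as 0^0 = 1 in the additional term; for
    m > 0 without second moment the right-hand side is infinite. *)
Lemma renewal_count_moment_le (t : R) (m : nat) : (0 <= t)%R ->
  \int[P]_w (renewal_count X t w) ^+ m <=
  ((2 : R) ^ (m%:Z - 1))%:E * moment_bound lambda Y t m.
Proof.
move=> t0; case: m => [|m].
  under eq_integral do rewrite expe0.
  rewrite integral_cst// [X in 1 * X](@probability_setT _ _ _ P).
  rewrite /moment_bound !expe0 !expr0 !mule1 -EFinD -EFinM lee_fin.
  by rewrite sub0r exprN1 -[X in (_ * X)%R]/(2%:R)%R mulVf.
have e : (m.+1%:Z - 1 = m%:Z)%R by rewrite -addn1 PoszD addrK.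
rewrite e -exprnP.
have lt0 : (0 <= lambda * t)%R by rewrite mulr_ge0// ltW.
have := second_moment_ge1 l0 EY.
rewrite /moment_bound; move EY2 : ('E_P[_]) => b; move: b EY2 => [b| |] EY2 //.
  rewrite lee_fin => b1.
  have b0 : (0 < b)%R by rewrite (lt_le_trans _ b1).
  apply: (@le_trans _ _ (m.+1`!%:R * (2 * (lambda * t) + b) ^+ m.+1)%:E).
    apply: (le_trans (renewal_count_le X0 m t0)).
    apply: lime_le.
      apply: is_cvg_nneseries => n _ _.
      by rewrite mule_ge0// lee_fin mulr_ge0// exprn_ge0.
    apply: nearW => N.
    have Pfin n : P (early X t n) \is a fin_num.
      by rewrite fin_num_measure//; exact: measurable_early.
    under eq_bigr do rewrite -(fineK (Pfin _)) -EFinM -mulrA.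
    rewrite sumEFin lee_fin -mulr_sumr factS natrM -mulrA ler_wpM2l//.
    apply: (@moment_sum_le _ (fun n => fine (P (early X t n.+1)))).
    - by move=> n; rewrite fine_ge0.
    - rewrite -lee_fin fineK// probability_le1//; exact: measurable_early.
    - by rewrite addr_ge0 ?mulr_ge0// ltW.
    - exact: early_prob_tail.
  rewrite -!(EFinM, EFinD, EFin_expe) lee_fin.
  rewrite (le_trans (moment_const_le m lt0 b1))// ler_wpM2l ?exprn_ge0//.
  by rewrite exprMn lerDl exprn_ge0.
move=> _; have inf : (1 + m.+1%:R%:E * +oo) ^+ m.+1 = +oo :> \bar R.
  rewrite gt0_muley ?lte_fin// addey//.
  by elim: (m) => [//|k ih]; rewrite expeS ih mulyy.
have lt1 : (0 < 1 + lambda * t)%R by rewrite ltr_wpDr.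
by rewrite inf gt0_muley ?lte_fin ?exprn_gt0// addye// gt0_muley ?leey// lte_fin exprn_gt0.
Qed.

End delayed_moment_bound.

Theorem lemmaA2 (R : realType) :
  (forall (d : measure_display) (T : measurableType d) (P : probability T R)
      (lambda : R) (xi : nat -> {RV P >-> R}),
    (0 < lambda)%R -> renewal_sequence lambda xi ->
    forall (m : nat) (t : R), (0 <= t)%R ->
      \int[P]_w (renewal_count xi t w) ^+ m <=
      ((2 : R) ^ (m%:Z - 1))%:E * moment_bound lambda (xi 0%N) t m)
  /\
  (exists C' : R, (1 < C')%R /\
    forall (d : measure_display) (T : measurableType d) (P : probability T R)
      (lambda : R) (D : {RV P >-> R}) (xi : nat -> {RV P >-> R}),
    (0 < lambda)%R -> equilibrium_renewal_sequence lambda D xi ->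
    forall (m : nat) (t : R), (0 <= t)%R ->
      \int[P]_w (renewal_count (delayed D xi) t w) ^+ m <=
      (C' ^+ m)%:E * moment_bound lambda (xi 0%N) t m).
Proof.
split=> [d T P lambda xi l0 [ind ident pos mean] m t t0|].
  apply: renewal_count_moment_le => //; last by move=> k B mB; exact: ident.
  by apply: ae_foralln => k; apply: filterS (pos k) => w /ltW.
(* The delayed count obeys the bound with 2^(m-1), and 2^(m-1) <= 2^m. *)
exists 2%R; split; first by rewrite ltr1n.
move=> d T P lambda D xi l0 [[ind ident pos mean] indD cdfD] m t t0.
apply: (@le_trans _ _
    (((2 : R) ^ (m%:Z - 1))%:E * moment_bound lambda (xi 0%N) t m)).
  apply: renewal_count_moment_le => //.
  apply: ae_foralln => -[|k]; last by apply: filterS (pos k) => w /ltW.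
  (* The cdf of the delay vanishes at 0, as an integral over a point. *)
  have mD : measurable (D @^-1` `]-oo, 0%R]).
    by rewrite -[X in measurable X]setTI; exact: measurable_funP.
  exists (D @^-1` `]-oo, 0%R]); split => //.
    have := cdfD 0%R (lexx _); rewrite set_itv1 integral_set1 mule0.
    by rewrite /cdf /distribution /pushforward.
  by move=> w /= /negP; rewrite -ltNge in_itv/= => /ltW.
rewrite lee_wpmul2r//.
  rewrite /moment_bound adde_ge0 ?mule_ge0 ?expe_ge0 ?lee_fin ?exprn_ge0//.
  - by rewrite addr_ge0// mulr_ge0// ltW.
  - by rewrite adde_ge0// mule_ge0// expectation_ge0// => w; exact: sqr_ge0.
by rewrite lee_fin exprnP; apply: ler_weXz2l; rewrite ?ler1n// gerBl.
Qed.
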